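(* For any graphs $G$ and $H$ with no isolated vertex, $$\gamma_{R}(G\times H)\leq 2\gamma_t(G)\gamma_{t}(H)-2k(G)k(H).$$
   Context: All graphs are finite and simple. The direct product $G\times H$ has vertex set $V(G)\times V(H)$, with $(u,v)$ adjacent to $(u',v')$ iff $uu'\in E(G)$ and $vv'\in E(H)$. A set $S$ is dominating if every vertex is in $S$ or adjacent to a vertex of $S$. A set $D$ is total dominating if every vertex has a neighbor in $D$; $\gamma_t(G)$ is the minimum size of a total dominating set, and a total dominating set of this size is a $\gamma_t(G)$-set. For a $\gamma_t(G)$-set $D$, let $D'\subseteq D$ be a dominating set of $G$ of minimum cardinality among dominating sets of $G$ contained in $D$; the set $D\setminus D'$ is called a kernel of $D$. $k(G)$ denotes the maximum cardinality of $D\setminus D'$ over all $\gamma_t(G)$-sets $D$ and all such $D'$. A Roman dominating function on $G$ is $f:V(G)\to\{0,1,2\}$ such that every vertex with value $0$ has a neighbor with value $2$; $\gamma_R(G)$ is the minimum of $\sum_v f(v)$ over such $f$. *)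

(* Defs.v *)
From mathcomp Require Import all_boot.

Set Implicit Arguments.
Unset Strict Implicit.
Unset Printing Implicit Defensive.

Record sgraph := SGraph {
  vertex :> finType;
  adj : rel vertex;
  adj_sym : symmetric adj;
  adj_irrefl : irreflexive adj
}.

Definition direct_adj (G H : sgraph) : rel (G * H)%type :=
  fun x y => adj x.1 y.1 && adj x.2 y.2.

Lemma direct_adj_sym (G H : sgraph) : symmetric (@direct_adj G H).
Proof. by move=> x y; rewrite /direct_adj adj_sym (adj_sym x.2). Qed.

Lemma direct_adj_irrefl (G H : sgraph) : irreflexive (@direct_adj G H).
Proof. by move=> x; rewrite /direct_adj adj_irrefl. Qed.

Definition direct_product (G H : sgraph) : sgraph :=
  SGraph (@direct_adj_sym G H) (@direct_adj_irrefl G H).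

Definition no_isolated_vertex (G : sgraph) : Prop :=
  forall v : G, exists u : G, adj v u.

Definition dominating (G : sgraph) (S : {set G}) : bool :=
  [forall v : G, (v \in S) || [exists u in S, adj v u]].

Definition total_dominating (G : sgraph) (D : {set G}) : bool :=
  [forall v : G, [exists u in D, adj v u]].

(* The default [set: G] of the arg min is a genuine total dominating set
   exactly when G has no isolated vertex; otherwise G has none at all. *)
Definition gamma_t (G : sgraph) : nat :=
  #|[arg min_(D < [set: G] | total_dominating D) #|D| ]|.

Definition gamma_t_set (G : sgraph) (D : {set G}) : bool :=
  total_dominating D && (#|D| == gamma_t G).

Definition min_dominating_within (G : sgraph) (D D' : {set G}) : bool :=
  [&& D' \subset D, dominating D'
    & [forall S : {set G},
        (S \subset D) && dominating S ==> (#|D'| <= #|S|)]].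

Definition is_kernel (G : sgraph) (D K : {set G}) : bool :=
  [exists D' : {set G}, min_dominating_within D D' && (K == D :\: D')].

Definition kernel_number (G : sgraph) : nat :=
  \max_(D : {set G} | gamma_t_set D) \max_(K : {set G} | is_kernel D K) #|K|.

(* Hence gamma_t G * gamma_t H - kernel_number G * kernel_number H
   never truncates. *)
Lemma kernel_number_le (G : sgraph) : kernel_number G <= gamma_t G.
Proof.
apply/bigmax_leqP => D /andP[_ /eqP <-].
apply/bigmax_leqP => K /existsP[D' /andP[_ /eqP ->]].
exact/subset_leq_card/subsetDl.
Qed.

Definition roman_dominating (G : sgraph) (f : {ffun G -> 'I_3}) : bool :=
  [forall v : G, (f v == 0 :> nat) ==>
    [exists u : G, adj v u && (f u == 2 :> nat)]].

Definition weight (G : sgraph) (f : {ffun G -> 'I_3}) : nat :=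
  \sum_(v : G) f v.

(* The default, constantly 2, is always a Roman dominating function. *)
Definition gamma_R (G : sgraph) : nat :=
  weight [arg min_(f < [ffun _ : G => ord_max : 'I_3] | roman_dominating f)
            weight f].

(* Main.v *)
(* Let K = D \ D' and L = E \ E' be kernels of maximum cardinality of
   minimum total dominating sets D of G and E of H.  Assigning 2 to the vertices
   of (D x E) \ (K x L) and 0 to the others is a Roman dominating function: if u
   has a neighbor in D' or v has a neighbor in E', then (u, v) has a neighbor in
   (D' x E) :|: (D x E'); otherwise u is in D' and v is in E', so (u, v) itself
   has value 2. *)
Require Import Defs.
From mathcomp Require Import all_boot.

(** Value 2 on [S] and 0 elsewhere is Roman dominating, of weight [2 * #|S|]. *)
Lemma gamma_R_le_dominating {G : sgraph} {S : {set G}} :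
  dominating S -> gamma_R G <= 2 * #|S|.
Proof.
move=> /forallP domS.
pose f := [ffun v : G => if v \in S then ord_max : 'I_3 else ord0].
have romf : roman_dominating f.
  apply/forallP => v; apply/implyP; rewrite ffunE.
  have := domS v; case: (v \in S) => //= /existsP[u /andP[uS vu]] _.
  by apply/existsP; exists u; rewrite vu ffunE uS.
have <- : weight f = 2 * #|S|.
  rewrite mulnC -sum_nat_const big_mkcond /weight.
  by apply: eq_bigr => v _; rewrite ffunE; case: (v \in S).
rewrite /gamma_R; case: arg_minnP => [|g _]; last exact.
by apply/forallP => v; rewrite ffunE.
Qed.

Lemma total_dominating_dominating {G : sgraph} {D : {set G}} :
  total_dominating D -> dominating D.
Proof. by move=> /forallP tD; apply/forallP => v; rewrite tD orbT. Qed.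

Lemma gamma_t_set_exists {G : sgraph} :
  no_isolated_vertex G -> exists D : {set G}, gamma_t_set D.
Proof.
move=> hG; exists [arg min_(D < [set: G] | total_dominating D) #|D| ].
rewrite /gamma_t_set eqxx andbT; case: arg_minnP => //.
apply/forallP => v; have [u vu] := hG v.
by apply/existsP; exists u; rewrite inE.
Qed.

Lemma kernel_exists {G : sgraph} {D : {set G}} :
  dominating D -> exists K : {set G}, is_kernel D K.
Proof.
move=> domD; pose P (S : {set G}) := (S \subset D) && dominating S.
have PD : P D by rewrite /P subxx.
have [D' /andP[sD' domD'] minD'] := arg_minnP (fun S : {set G} => #|S|) PD.
exists (D :\: D'); apply/existsP; exists D'.
rewrite eqxx andbT; apply/and3P; split=> //.
by apply/forallP => S; apply/implyP; exact: minD'.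
Qed.

(** Both nested maxima range over nonempty families, so neither is the default 0 of an empty [\max]
    and each is reached. *)
Lemma kernel_number_attained {G : sgraph} : no_isolated_vertex G ->
  exists D D' : {set G},
    [/\ total_dominating D, #|D| = gamma_t G, dominating D', D' \subset D
      & #|D :\: D'| = kernel_number G].
Proof.
move=> hG; have [D0 gD0] := gamma_t_set_exists hG.
have [D gD kD] : {D : {set G} | gamma_t_set D &
    kernel_number G = \max_(K : {set G} | is_kernel D K) #|K|}.
  by apply: eq_bigmax_cond; apply/card_gt0P; exists D0.
have /andP[tD /eqP cD] := gD.
have [K0 kK0] := kernel_exists (total_dominating_dominating tD).
have [K kK eK] : {K : {set G} | is_kernel D K &
    \max_(K : {set G} | is_kernel D K) #|K| = #|K|}.
  by apply: eq_bigmax_cond; apply/card_gt0P; exists K0.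
have /existsP[D' /andP[/and3P[sD' domD' _] /eqP defK]] := kK.
by exists D, D'; split; rewrite // -defK kD eK.
Qed.

Lemma dominating_direct_product {G H : sgraph}
    {D D' : {set G}} {E E' : {set H}} :
  total_dominating D -> D' \subset D -> dominating D' ->
  total_dominating E -> E' \subset E -> dominating E' ->
  @dominating (direct_product G H)
    (setX D E :\: setX (D :\: D') (E :\: E')).
Proof.
move=> /forallP tD /subsetP sD /forallP domD /forallP tE /subsetP sE.
move=> /forallP domE; apply/forallP => -[u v].
(* [x] and [y] serve as the free coordinate of the neighbor of [(u, v)] in the first two cases. *)
have /existsP[x /andP[xD ux]] := tD u.
have /existsP[y /andP[yE vy]] := tE v.
have [/existsP[z /andP[zD' uz]]|nu] := boolP [exists z in D', adj u z].
  (* As [z] is in [D'], the pair avoids the removed product whatever [y] is. *)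
  apply/orP; right; apply/existsP; exists (z, y).
  by rewrite !inE /= zD' sD // yE /= /direct_adj /= uz vy.
have [/existsP[z /andP[zE' vz]]|nv] := boolP [exists z in E', adj v z].
  apply/orP; right; apply/existsP; exists (x, z).
  by rewrite !inE /= zE' sE // xD /= andbF /= /direct_adj /= ux vz.
(* Without a neighbor in [D'], [u] can only be dominated by itself; likewise [v]. *)
have := domD u; rewrite (negbTE nu) orbF => uD'.
have := domE v; rewrite (negbTE nv) orbF => vE'.
by rewrite !inE /= uD' !sD ?sE.
Qed.

Theorem theorem2p6 (G H : sgraph)
  (hG : no_isolated_vertex G) (hH : no_isolated_vertex H) :
  gamma_R (direct_product G H)
    <= 2 * gamma_t G * gamma_t H - 2 * kernel_number G * kernel_number H.
Proof.
have [D [D' [tD <- domD' sD' <-]]] := kernel_number_attained hG.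
have [E [E' [tE <- domE' sE' <-]]] := kernel_number_attained hH.
have domS := dominating_direct_product tD sD' domD' tE sE' domE'.
apply: leq_trans (gamma_R_le_dominating domS) _.
(* After cancelling 2, both sides agree: the removed product lies inside [setX D E], so its
   cardinality is subtracted in full. *)
rewrite -!mulnA -mulnBr leq_mul2l /= -!cardsX cardsD.
by rewrite (setIidPr _) // setXS // subsetDl.
Qed.
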